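(* Let $\boldsymbol\lambda=\{\lambda_n\}_{n=1}^\infty\subseteq\mathbb{C}$, let $W_{\boldsymbol\lambda}$ be the unilateral weighted shift in $\ell^2(\mathbb{N})$ with weights $\boldsymbol\lambda$, and let $C$ be a conjugation on $\ell^2(\mathbb{N})$. If $W_{\boldsymbol\lambda}$ is $C$-symmetric and $C\mathcal{E}\subseteq \mathcal{D}^\infty(W_{\boldsymbol\lambda})$, then $W_{\boldsymbol\lambda}$ is $C$-selfadjoint. Moreover, $W_{\boldsymbol\lambda}$ can be decomposed into an orthogonal sum $W_{\boldsymbol\lambda}=\bigoplus_{i\in\mathcal{I}} J_{\boldsymbol\lambda^{(i)}}$, where each $J_{\boldsymbol\lambda^{(i)}}$, $i\in\mathcal{I}$, is a truncated weighted shift on $\mathbb{C}^{n_i}$ with weights $\boldsymbol\lambda^{(i)}=\{\lambda^{(i)}_1,\ldots,\lambda^{(i)}_{n_i-1}\}$ satisfying $|\lambda_k^{(i)}|=|\lambda_{n_i-k}^{(i)}|$ for $k=1,\ldots,n_i-1$.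
   Context: $\mathbb{N}=\{1,2,\ldots\}$ and $\mathcal{E}=\{e_n\}_{n\in\mathbb{N}}$ is the standard orthonormal basis of the complex Hilbert space $\ell^2(\mathbb{N})$. $\mathcal{D}(T)$ denotes the domain of an operator $T$, and $\mathcal{D}^\infty(T)=\bigcap_{n=1}^\infty\mathcal{D}(T^n)$. The unilateral weighted shift $W_{\boldsymbol\lambda}$ with weights $\boldsymbol\lambda=\{\lambda_n\}_{n=1}^\infty\subseteq\mathbb{C}$ is the (possibly unbounded) operator in $\ell^2(\mathbb{N})$ with domain $\mathcal{D}(W_{\boldsymbol\lambda})=\{f\in\ell^2(\mathbb{N}):\sum_{n=1}^\infty|f(n)\lambda_n|^2<\infty\}$ and $(W_{\boldsymbol\lambda}f)(n)=\lambda_{n-1}f(n-1)$ for $n\in\mathbb{N}$, with $\lambda_0=f(0):=0$; so $W_{\boldsymbol\lambda}e_n=\lambda_ne_{n+1}$. Weights may be zero. For $k\in\mathbb{N}$ and $\boldsymbol\lambda=\{\lambda_1,\ldots,\lambda_{k-1}\}\subseteq\mathbb{C}$, the truncated weighted shift $J_{\boldsymbol\lambda}$ is the linear operator on $\mathbb{C}^k$ with $J_{\boldsymbol\lambda}e_i=\lambda_ie_{i+1}$ for $i=1,\ldots,k-1$ and $J_{\boldsymbol\lambda}e_k=0$ (weights may be zero; for $k=1$ it is the zero operator on $\mathbb{C}$). A conjugation on a complex Hilbert space $\mathcal{H}$ is an antilinear map $C:\mathcal{H}\to\mathcal{H}$ with $C^2=I$ and $\langle Cf,Cg\rangle=\langle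 g,f\rangle$ for all $f,g\in\mathcal{H}$. A densely defined operator $T$ in $\mathcal{H}$ is $C$-symmetric if $T\subseteq CT^*C$ and $C$-selfadjoint if $T=CT^*C$. The orthogonal sum $\bigoplus_i T_i$ of operators $T_i$ in $\mathcal{H}_i$ has domain $\{(f_i): f_i\in\mathcal{D}(T_i),\ \sum_i\|f_i\|^2<\infty,\ \sum_i\|T_if_i\|^2<\infty\}$ and acts coordinatewise. The decomposition of $W_{\boldsymbol\lambda}$ is understood with respect to an orthogonal decomposition of $\ell^2(\mathbb{N})$ into finite-dimensional summands identified unitarily with the spaces $\mathbb{C}^{n_i}$. *)

(* Defs.v *)
From HB Require Import structures.
From mathcomp Require Import all_boot all_order all_algebra.
From mathcomp Require Import complex ring.
From mathcomp Require Import all_classical all_reals.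
From mathcomp Require Import ereal topology normedtype sequences esum.

Set Implicit Arguments.
Unset Strict Implicit.
Unset Printing Implicit Defensive.

Import Order.TTheory GRing.Theory Num.Theory.
Import numFieldNormedType.Exports.

Local Open Scope classical_set_scope.
Local Open Scope ring_scope.

(* MathComp-Analysis.  The complex field is [R[i]] for [R : realType].
   Positive integers are shifted by one: coordinate, weight and basis vector
   number [n : nat] stand for those of index n + 1 in {1, 2, ...}. *)

Local Notation normc := ComplexField.Normc.normc.

Section SquareSummable.
Context {R : realType}.

Definition sqsum (X : choiceType) (a : X -> R) : \bar R :=
  \esum_(x in [set: X]) (a x ^+ 2)%:E.

Definition sq_summable (X : choiceType) (a : X -> R) : Prop :=
  (sqsum a < +oo)%E.

Definition l2_pred : {pred nat -> R[i]} :=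
  [pred f : nat -> R[i] | `[< sq_summable (fun n => normc (f n)) >]].

Lemma normcD_sq (x y : R[i]) :
  normc (x + y) ^+ 2 <= 2 * normc x ^+ 2 + 2 * normc y ^+ 2.
Proof.
case: x => a b; case: y => c d /=.
rewrite !sqr_sqrtr ?addr_ge0 ?sqr_ge0// -subr_ge0.
rewrite [leRHS](_ : _ = (a - c) ^+ 2 + (b - d) ^+ 2); last by ring.
by rewrite addr_ge0 ?sqr_ge0.
Qed.

Lemma l2_submod_closed : submod_closed l2_pred.
Proof.
split.
  apply/asboolP; rewrite /sq_summable /sqsum esum1 ?ltry// => n _.
  by rewrite /= expr0n/= addr0 sqrtr0 expr0n.
move=> a f g /asboolP lf /asboolP lg; apply/asboolP.
set u := fun n => (2 * normc a ^+ 2 * normc (f n) ^+ 2)%:E : \bar R.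
set v := fun n => (2 * normc (g n) ^+ 2)%:E : \bar R.
have scale_lty (c : R) (h : nat -> R[i]) : 0 <= c ->
    sq_summable (fun n => normc (h n)) ->
    (\esum_(n in [set: nat]) (c * normc (h n) ^+ 2)%:E < +oo)%E.
  move=> c0 lh; rewrite -nneseries_esumT; last first.
    by move=> n; rewrite lee_fin mulr_ge0// sqr_ge0.
  under eq_eseriesr do rewrite EFinM.
  rewrite nneseriesZl; last by move=> n _; rewrite lee_fin sqr_ge0.
  rewrite nneseries_esumT; last by move=> n; rewrite lee_fin sqr_ge0.
  by rewrite lte_mul_pinfty ?lee_fin.
apply: (@le_lt_trans _ _ (\esum_(n in [set: nat]) (u n + v n))%E).
  apply: le_esum => n _; rewrite lee_fin (le_trans (normcD_sq _ _))//.
  by rewrite lerD2r ComplexField.Normc.normcM exprMn mulrA.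
have a0 : 0 <= 2 * normc a ^+ 2 by rewrite mulr_ge0 // sqr_ge0.
rewrite esumD.
- by rewrite lte_add_pinfty //; apply: scale_lty.
- by move=> m _; rewrite /u lee_fin mulr_ge0 // sqr_ge0.
- by move=> m _; rewrite /v lee_fin mulr_ge0 // sqr_ge0.
Qed.

HB.instance Definition _ :=
  GRing.isSubmodClosed.Build _ _ l2_pred l2_submod_closed.

Record l2 : Type := L2 { l2_val :> nat -> R[i] ; _ : l2_val \in l2_pred }.

HB.instance Definition _ := [isSub for l2_val].
HB.instance Definition _ := [Choice of l2 by <:].
HB.instance Definition _ := [SubChoice_isSubLmodule of l2 by <:].

Lemma l2_basis_subproof (n : nat) :
  (fun m => (m == n)%:R : R[i]) \in l2_pred.
Proof.
apply/asboolP; rewrite /sq_summable /sqsum (esumID [set n])//; last first.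
  by move=> m _; rewrite lee_fin sqr_ge0.
rewrite !setTI [X in (_ + X)%E]esum1; last first.
  move=> m /= /eqP/negPf ->.
  by rewrite ComplexField.Normc.normc0 expr0n.
by rewrite esum_set1 ?lee_fin ?sqr_ge0// adde0 ltry.
Qed.

Definition l2_basis (n : nat) : l2 := L2 (l2_basis_subproof n).

End SquareSummable.
Arguments l2 : clear implicits.

Section OperatorsInL2.
Context {R : realType}.
Local Notation H := (l2 R).

(* The sum over n of f n * (g n)^*, an absolutely convergent complex series,
   computed on real and imaginary parts. *)
Definition inner (f g : H) : R[i] :=
  Complex (limn (series (fun n => complex.Re (f n * (g n)^*))))
          (limn (series (fun n => complex.Im (f n * (g n)^*)))).

Definition l2_norm (f : H) : R :=
  Num.sqrt (fine (sqsum (fun n => normc (f n)))).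

(* An operator T, possibly unbounded and not everywhere defined, is its graph
   {(f, T f) : f in D(T)}. *)
Definition dom (V : Type) (T : set (V * V)) : set V :=
  [set f | exists g, T (f, g)].

Fixpoint op_pow (V : Type) (T : set (V * V)) (n : nat) : set (V * V) :=
  if n is m.+1 then (T \; op_pow T m)%relation else [set p | p.2 = p.1].

Definition dom_infty (V : Type) (T : set (V * V)) : set V :=
  \bigcap_(n in [set n | (1 <= n)%N]) dom (op_pow T n).

Definition densely_defined (T : set (H * H)) : Prop :=
  forall (f : H) (e : R), 0 < e -> exists2 g, dom T g & l2_norm (f - g) < e.

(* For densely defined T this is the graph of the adjoint operator. *)
Definition adjoint (T : set (H * H)) : set (H * H) :=
  [set p | forall f Tf, T (f, Tf) -> inner Tf p.1 = inner f p.2].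

Definition conjugation (C : H -> H) : Prop :=
  [/\ forall (a : R[i]) f g, C (a *: f + g) = a^* *: C f + C g,
      forall f, C (C f) = f
    & forall f g, inner (C f) (C g) = inner g f].

Definition fun_graph (V : Type) (F : V -> V) : set (V * V) :=
  [set p | p.2 = F p.1].

(* [A \; B] is the product of operators "B first applied, then A".  *)
Definition conj_op (C : H -> H) (T : set (H * H)) : set (H * H) :=
  ((fun_graph C \; T) \; fun_graph C)%relation.

Definition C_symmetric (C : H -> H) (T : set (H * H)) : Prop :=
  densely_defined T /\ T `<=` conj_op C (adjoint T).

Definition C_selfadjoint (C : H -> H) (T : set (H * H)) : Prop :=
  densely_defined T /\ T = conj_op C (adjoint T).

Definition weighted_shift (lam : nat -> R[i]) : set (H * H) :=
  [set p : H * H | sq_summable (fun n => normc (p.1 n * lam n)) /\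
                   forall n, p.2 n = if n is m.+1 then lam m * p.1 m else 0].

End OperatorsInL2.

Section OrthogonalSum.
Context {R : realType}.

Definition cV_norm (k : nat) (x : 'cV[R[i]]_k) : R :=
  Num.sqrt (\sum_(j < k) normc (x j 0) ^+ 2).

(* J e_j = mu_j e_{j+1} for j < k and J e_k = 0 on the column vectors of
   length k + 1, with coordinates and weights numbered from 0. *)
Definition truncated_shift (k : nat) (mu : 'I_k -> R[i]) : 'M[R[i]]_k.+1 :=
  \sum_(j < k) mu j *: delta_mx (lift ord0 j) (widen_ord (leqnSn k) j).

Variables (I : choiceType) (n : I -> nat).
Local Notation family := (forall i, 'cV[R[i]]_(n i)).

Definition in_hsum (x : family) : Prop :=
  sq_summable (fun i => cV_norm (x i)).

Definition orthogonal_sum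
    (T : forall i, set ('cV[R[i]]_(n i) * 'cV[R[i]]_(n i))) :
    set (family * family) :=
  [set p | [/\ forall i, T i (p.1 i, p.2 i), in_hsum p.1 & in_hsum p.2]].

(* U is a unitary map of l2 onto the Hilbert space sum of the C^(n i); its
   adjoint embeds the C^(n i) as pairwise orthogonal subspaces of l2 with
   dense span. *)
Definition unitary_onto_hsum (U : l2 R -> family) : Prop :=
  [/\ forall (a : R[i]) f g i, U (a *: f + g) i = a *: U f i + U g i,
      forall f, sqsum (fun i => cV_norm (U f i)) = sqsum (fun m => normc (f m))
    & forall x : family, in_hsum x -> exists f, U f = x].

End OrthogonalSum.

(* Main.v *)
Require Import Defs.
From mathcomp Require Import all_boot all_order all_algebra.
From mathcomp Require Import complex.
From mathcomp Require Import all_classical all_reals.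
From mathcomp Require Import ereal topology normedtype sequences esum.
From mathcomp Require Import lra zify.

(* Write c(a,b) for the b-th coordinate of C e_a. This matrix is symmetric and
   unitary, and C-symmetry together with C e_a in D(W) gives, with indices
   starting from 0,
     lam_m c(n+1,m) = lam_n c(n,m+1)   and   lam_m c(0,m) = 0,
   and the first relation also holds with lam_m and lam_n replaced by the
   conjugates of lam_n and lam_m. Testing the adjoint against C e_a, on which W
   is thus known, yields C-selfadjointness.

   If c(a,b) <> 0 then |lam_(a-1)| = |lam_b|, and the entry (a+1,b-1) is again
   nonzero as long as lam_a <> 0. Hence infinitely many weights vanish, W is the
   direct sum of the blocks between consecutive zero weights, and c links the
   first vector of a block s with the last vector of a block t only if the moduli
   of the weights of t are those of s in reverse order. As |c(a,b)|^2 is doubly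
   stochastic, double counting shows that a word of moduli and its reverse occur
   equally often. The r-th block of each word is therefore paired with the r-th
   block of the reversed word: a block which is its own partner is palindromic,
   and concatenating two distinct partners (with weight 0 at the joint) gives a
   palindromic truncated shift. *)

Set Implicit Arguments.
Unset Strict Implicit.
Unset Printing Implicit Defensive.

Import Order.TTheory GRing.Theory Num.Theory.
Import numFieldNormedType.Exports.

Local Open Scope classical_set_scope.
Local Open Scope ring_scope.

Local Notation normc := ComplexField.Normc.normc.

(** Prefix counts grow by at most one at each step, so every value below the total is reached just
    before some element of [P]. *)
Lemma exists_count (P : pred nat) k N :
  (k < count P (iota 0 N))%N -> exists2 j, P j & count P (iota 0 j) = k.
Proof.
elim: N => // N IH; rewrite -[in iota 0 N.+1]addn1 iotaD count_cat /=.
rewrite add0n addn0 => kN.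
have [/IH//|Nk] := ltnP k (count P (iota 0 N)).
by exists N; move: kN Nk; case: (P N) => /=; lia.
Qed.

(** The value 0 before the first weight makes index 0 the start of a block. *)
Definition pred_weight (V : nmodType) (w : nat -> V) (n : nat) : V :=
  if n is m.+1 then w m else 0.

(** * Blocks between consecutive zero weights *)

Section Blocks.
Variables (R : realFieldType) (w : nat -> R).
Hypothesis w_zero : forall n, exists l, w (n + l) == 0.

Definition is_start (s : nat) : bool := pred_weight w s == 0.

(** Only the nonzero weights are counted: the block of a start [s] has [len s + 1] basis vectors,
    the last at [s + len s]. *)
Definition len (s : nat) : nat := ex_minn (w_zero s).

Lemma weight_end s : w (s + len s) = 0.
Proof. by rewrite /len; case: ex_minnP => l /eqP. Qed.

Lemma weight_inside s i : (i < len s)%N -> w (s + i) != 0.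
Proof.
rewrite /len; case: ex_minnP => l _ lmin ltil; apply/negP => /lmin.
by rewrite leqNgt ltil.
Qed.

Definition btype (s : nat) : seq R := mkseq (fun i => w (s + i)) (len s).

Lemma size_btype s : size (btype s) = len s.
Proof. exact: size_mkseq. Qed.

Lemma nth_btype s i : (i < len s)%N -> nth 0 (btype s) i = w (s + i).
Proof. by move=> il; rewrite nth_mkseq. Qed.

Fixpoint start_of (n : nat) : nat :=
  if n is m.+1 then if w m == 0 then n else start_of m else 0.

Lemma start_of_start n : is_start (start_of n).
Proof.
elim: n => [|n IH] /=; first by rewrite /is_start eqxx.
by case: ifP => // wn; rewrite /is_start /= wn.
Qed.

Lemma start_of_le n : (start_of n <= n)%N.
Proof. by elim: n => [|n IH] //=; case: ifP => // _; exact: leqW. Qed.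

Lemma le_start_of_end n : (n <= start_of n + len (start_of n))%N.
Proof.
elim: n => [|n IH] //=; case: ifPn => wn; first exact: leq_addr.
move: IH; rewrite leq_eqVlt => /orP[/eqP en|//].
by move: wn; rewrite {1}en weight_end eqxx.
Qed.

Lemma start_of_add s j : is_start s -> (j <= len s)%N -> start_of (s + j) = s.
Proof.
move=> ss; elim: j => [_|j IH jl].
  rewrite addn0; case: s ss => [|s] //=; rewrite /is_start /=.
  by move=> ->.
by rewrite addnS /= (negPf (weight_inside jl)) IH // ltnW.
Qed.

Lemma start_of_end b : w b = 0 -> b = (start_of b + len (start_of b))%N.
Proof.
move=> wb; apply/eqP; rewrite eqn_leq le_start_of_end leqNgt; apply/negP => lt.
have lenb : (b - start_of b < len (start_of b))%N.
  by have := start_of_le b; lia.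
by have := weight_inside lenb; rewrite subnKC ?start_of_le // wb eqxx.
Qed.

(** Together with the word [btype s], this number identifies a block. *)
Definition rank (s : nat) : nat :=
  count (fun t => is_start t && (btype t == btype s)) (iota 0 s).

Lemma rank_inj s t :
  is_start s -> is_start t -> btype s = btype t -> rank s = rank t -> s = t.
Proof.
have lt_rank a b : is_start a -> btype a = btype b -> (a < b)%N ->
    (rank a < rank b)%N.
  move=> sa tab ab; rewrite /rank -tab -[in iota 0 b](subnKC ab) iotaD.
  by rewrite -[in iota 0 a.+1]addn1 iotaD !count_cat /= sa eqxx /=; lia.
move=> ss st tst rst; case: (ltngtP s t) => // lt_st.
  by have := lt_rank _ _ ss tst lt_st; rewrite rst ltnn.
by have := lt_rank _ _ st (esym tst) lt_st; rewrite rst ltnn.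
Qed.

(* In the application, p a b is the squared modulus of coordinate b of C e_a. *)
Variable p : nat -> nat -> R.
Hypothesis p_ge0 : forall a b, 0 <= p a b.
Hypothesis p_sym : forall a b, p a b = p b a.
Hypothesis p_support : forall a b, p a b != 0 -> pred_weight w a = w b.
Hypothesis p_shift : forall a b, w a != 0 -> p a b.+1 != 0 -> p a.+1 b != 0.
Hypothesis p_le1 : forall a N, \sum_(b <- iota 0 N) p a b <= 1.
Hypothesis p_ge1 : forall a e, 0 < e ->
  exists N, 1 - e < \sum_(b <- iota 0 N) p a b.

Lemma p_support_r a b : p a b != 0 -> pred_weight w b = w a.
Proof. by rewrite p_sym; exact: p_support. Qed.

(** Walk along the antidiagonal from [(s, t + len t)]: nonzero weights after [s] keep the entries
    nonzero, and the support condition at each entry equates a weight of one block with the mirrored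
    weight of the other. *)
Lemma btype_rev_of_support s t :
  is_start t -> p s (t + len t) != 0 -> btype t = rev (btype s).
Proof.
move=> /eqP st pst.
have along i : (i <= len s)%N -> (i <= len t)%N ->
    p (s + i) (t + (len t - i)) != 0.
  elim: i => [|i IH] is_ it; first by rewrite addn0 subn0.
  have -> : (s + i.+1 = (s + i).+1)%N by lia.
  apply: p_shift; first exact: weight_inside.
  have -> : ((t + (len t - i.+1)).+1 = t + (len t - i))%N by lia.
  by apply: IH; lia.
have pw_inside i : (i < len t)%N ->
    pred_weight w (t + (len t - i)) = w (t + (len t - i.+1)).
  by move=> it; have -> : (t + (len t - i) = (t + (len t - i.+1)).+1)%N by lia.
have w_eq i : (i <= len s)%N -> (i < len t)%N ->
    w (s + i) = w (t + (len t - i.+1)).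
  by move=> is_ it; rewrite -pw_inside // (p_support_r (along _ is_ (ltnW it))).
have w_neq0 i : (i < len t)%N -> w (t + (len t - i.+1)) != 0.
  by move=> it; apply: weight_inside; lia.
(* Unequal lengths would identify a nonzero weight inside the longer block with a zero weight
   bounding the shorter one. *)
have eq_len : len s = len t.
  apply/eqP; rewrite eqn_leq; apply/andP; split; rewrite leqNgt; apply/negP => lt.
    have := along (len t) (ltnW lt) (leqnn _); rewrite subnn addn0.
    by move=> /p_support_r/esym; rewrite st => /eqP; apply/negP/weight_inside.
  by have := w_neq0 _ lt; rewrite -w_eq // weight_end eqxx.
apply: (@eq_from_nth _ 0) => [|i]; rewrite ?size_rev !size_btype // => it.
rewrite nth_rev ?size_btype ?eq_len // !nth_btype; try lia.
rewrite w_eq; try lia.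
by congr (w (t + _)); lia.
Qed.

(** Partial row sums increase with [N], so finitely many rows admit a common truncation. *)
Lemma row_mass_uniform (F : seq nat) e : 0 < e ->
  exists N, forall a, a \in F -> 1 - e <= \sum_(b <- iota 0 N) p a b.
Proof.
move=> e0; elim: F => [|a F [N IH]]; first by exists 0.
have [M aM] := p_ge1 a e0; exists (maxn M N).
have mono c K L : (K <= L)%N ->
    \sum_(b <- iota 0 K) p c b <= \sum_(b <- iota 0 L) p c b.
  by move=> KL; rewrite -(subnKC KL) iotaD big_cat /= lerDl sumr_ge0.
move=> c; rewrite inE => /orP[/eqP ->|cF].
  by rewrite (le_trans (ltW aM)) // mono // leq_maxl.
by rewrite (le_trans (IH _ cF)) // mono // leq_maxr.
Qed.

(** Finite double counting: the [k + 1] blocks up to [s] with the word of [s] force more than [k]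
    blocks with the reversed word; the one preceded by exactly [k] of these is chosen. *)
Lemma exists_reversed_block s : is_start s ->
  exists t, [/\ is_start t, btype t = rev (btype s) & rank t = rank s].
Proof.
move=> ss; set k := rank s.
pose P t := is_start t && (btype t == rev (btype s)).
pose F := [seq a <- iota 0 s.+1 | is_start a && (btype a == btype s)].
have sizeF : size F = k.+1.
  rewrite size_filter -[in iota 0 s.+1]addn1 iotaD count_cat /=.
  by rewrite ss eqxx /= !addn0 addn1.
suff [N kN] : exists N, (k < count P (iota 0 N))%N.
  have [t /andP[st /eqP tt] rt] := exists_count kN.
  by exists t; split => //; rewrite -rt /rank tt.
(* The [k + 1] rows together lose at most (k+1)/(k+2) < 1, which leaves a mass above [k]. *)
have e0 : 0 < k.+2%:R^-1 :> R by rewrite invr_gt0 ltr0Sn.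
have [N FN] := row_mass_uniform F e0.
exists N; rewrite -(ltr_nat R).
pose Q b := (w b == 0) && P (start_of b).
(* The rows in F have total mass more than k, while a column has mass at most 1
   and only the columns in Q meet these rows. *)
apply: (@lt_le_trans _ _ (\sum_(a <- F) \sum_(b <- iota 0 N) p a b)).
  apply: (@lt_le_trans _ _ (\sum_(a <- F) (1 - k.+2%:R^-1))); last first.
    by rewrite big_seq [leRHS]big_seq; apply: ler_sum => a /FN.
  rewrite big_const_seq count_predT iter_addr_0 sizeF -mulr_natr.
  have : k.+2%:R^-1 * k.+2%:R = 1 :> R by rewrite mulVf ?pnatr_eq0.
  move: e0; set x := _^-1; rewrite -!natr1 => x0 xk; nra.
apply: (@le_trans _ _ (\sum_(b <- iota 0 N | Q b) 1)).
  rewrite exchange_big /= [leRHS]big_mkcond /=; apply: ler_sum => b _.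
  case: ifPn => [_|nQ].
    (* By symmetry the column sum is part of the sum of row [b]. *)
    under eq_bigr do rewrite p_sym.
    apply: le_trans (p_le1 b s.+1); rewrite big_filter big_mkcond.
    by apply: ler_sum => a _; case: ifP.
  rewrite big1_seq // => a /andP[_].
  rewrite mem_filter => /andP[/andP[sa /eqP ta] _].
  apply/eqP; apply: contraNT nQ => pab; rewrite /Q /P.
  have wb : w b = 0 by rewrite -(p_support pab) (eqP sa).
  rewrite wb eqxx start_of_start -ta /=; apply/eqP/btype_rev_of_support => //.
    exact: start_of_start.
  by rewrite -start_of_end.
rewrite -big_filter big_const_seq count_predT iter_addr_0 ler_nat -size_filter.
(* A block has a single last index, so the columns in [Q] inject into the starts satisfying [P]. *)
rewrite -(size_map start_of); apply: uniq_leq_size.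
  rewrite map_inj_in_uniq ?filter_uniq ?iota_uniq // => b c.
  rewrite !mem_filter => /andP[/andP[/eqP wb _] _] /andP[/andP[/eqP wc _] _] bc.
  by rewrite (start_of_end wb) (start_of_end wc) bc.
move=> t /mapP[b]; rewrite !mem_filter !mem_iota => /andP[/andP[_ Pb] bN] ->.
by rewrite Pb /=; have := start_of_le b; lia.
Qed.

(** * Pairing of blocks with their reversals, and gluing of the pairs *)

Definition partner (s : nat) : nat :=
  xget 0 [set t | [/\ is_start t, btype t = rev (btype s) & rank t = rank s]].

Lemma partnerP s : is_start s ->
  [/\ is_start (partner s), btype (partner s) = rev (btype s)
    & rank (partner s) = rank s].
Proof.
move=> /exists_reversed_block [t st]; rewrite /partner.
by case: xgetP => [u _ //|/(_ t)].
Qed.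

(** The word is reversed twice and the rank is kept, so [rank_inj] applies. *)
Lemma partnerK s : is_start s -> partner (partner s) = s.
Proof.
move=> ss; have [sp tp rp] := partnerP ss; have [spp tpp rpp] := partnerP sp.
by apply: rank_inj => //; rewrite ?tpp ?tp ?revK // rpp.
Qed.

Lemma len_partner s : is_start s -> len (partner s) = len s.
Proof. by move=> /partnerP[_ tp _]; rewrite -!size_btype tp size_rev. Qed.

Lemma weight_partner s i : is_start s -> (i < len s)%N ->
  w (partner s + (len s - i.+1)) = w (s + i).
Proof.
move=> ss il; have [_ tp _] := partnerP ss.
have lp := len_partner ss.
rewrite -(nth_btype il) -nth_btype ?lp; last by lia.
rewrite tp nth_rev ?size_btype; last by lia.
by congr nth; lia.
Qed.

(** The smaller member of each pair indexes the summand, so that each pair is used once. *)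
Definition is_leader (s : nat) : bool := is_start s && (s <= partner s)%N.

(** Counts weights, not vectors: two blocks of [len s + 1] vectors carry [2 * len s + 1] weights,
    the middle one being the zero at the joint. *)
Definition glued_len (s : nat) : nat :=
  if partner s == s then len s else (len s + len s).+1.

Definition glued_pos (s j : nat) : nat :=
  if (j <= len s)%N then (s + j)%N else (partner s + (j - (len s).+1))%N.

Variant glued_spec s : nat -> nat -> Type :=
| GluedFirst j of (j <= len s)%N : glued_spec s j (s + j)
| GluedSecond j of (j <= len s)%N & partner s != s :
    glued_spec s ((len s).+1 + j) (partner s + j).

Lemma gluedP s j : (j <= glued_len s)%N -> glued_spec s j (glued_pos s j).
Proof.
rewrite /glued_len /glued_pos; case: (leqP j (len s)) => [jl _|lj jg].
  exact: GluedFirst.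
rewrite -{1}(subnKC lj); apply: GluedSecond; last first.
  by apply/negP => ps; move: jg; rewrite ps leqNgt lj.
by move: jg; case: ifP => _; lia.
Qed.

(** A jump at the joint is harmless: the shift kills the vector before it and maps nothing onto the
    vector after it. *)
Lemma glued_step s j : is_start s -> (j < glued_len s)%N ->
  glued_pos s j.+1 = (glued_pos s j).+1 \/
  w (glued_pos s j) = 0 /\ is_start (glued_pos s j.+1).
Proof.
move=> ss jg; rewrite /glued_pos; case: (ltngtP j (len s)) => [jl|lj|jl].
- by left; rewrite addnS.
- by left; rewrite -addnS; congr addn; lia.
- by right; rewrite jl weight_end subnn addn0; have [] := partnerP ss.
Qed.

(** For distinct partners, reversal exchanges the two halves and fixes the joint [j = len s]. *)
Lemma glued_palindrome s j : is_start s -> (j < glued_len s)%N ->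
  w (glued_pos s (glued_len s - j.+1)) = w (glued_pos s j).
Proof.
move=> ss; rewrite /glued_len; case: eqP => ps jl.
  rewrite /glued_pos !ifT; try lia.
  by rewrite -{1}ps weight_partner.
rewrite /glued_pos; case: (ltngtP j (len s)) => [jls|lj|->] /=.
- rewrite ifF; last by lia.
  by rewrite -[RHS]weight_partner //; congr (w (_ + _)); lia.
- rewrite ifT; last by lia.
  by rewrite -[LHS]weight_partner //; [congr (w (_ + _)); lia|lia].
- by rewrite ifT; [congr (w (_ + _)); lia|lia].
Qed.

(** [start_of] recovers the block containing the common position. In the mixed cases one leader
    would be the partner of the other and strictly larger than it, against its own leadership. *)
Lemma glued_inj s t i j : is_leader s -> is_leader t ->
  (i <= glued_len s)%N -> (j <= glued_len t)%N ->
  glued_pos s i = glued_pos t j -> s = t /\ i = j.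
Proof.
move=> /andP[ss lsp] /andP[st ltp].
have [sps _ _] := partnerP ss; have [spt _ _] := partnerP st.
have lps := len_partner ss; have lpt := len_partner st.
case/gluedP => {}i il => [|ps]; case/gluedP => {}j jl => [|pt] eq_pos;
  have := congr1 start_of eq_pos; rewrite !start_of_add ?lps ?lpt // => est.
- by split=> //; move: eq_pos; rewrite est => /addnI.
- have := lsp; rewrite est partnerK // leqNgt.
  by rewrite ltn_neqAle ltp eq_sym pt.
- have := ltp; rewrite -est partnerK // leqNgt.
  by rewrite ltn_neqAle lsp eq_sym ps.
- have {}est : s = t by rewrite -(partnerK ss) est partnerK.
  by split=> //; move: eq_pos; rewrite est => /addnI ->.
Qed.

Lemma glued_surj m :
  exists s j, [/\ is_leader s, (j <= glued_len s)%N & glued_pos s j = m].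
Proof.
set s := start_of m; have ss : is_start s := start_of_start m.
have [sp _ _] := partnerP ss; have lp := len_partner ss.
have sm : (s <= m)%N := start_of_le m.
have ml : (m <= s + len s)%N := le_start_of_end m.
have [sps|pss] := leqP s (partner s).
  exists s, (m - s)%N; split; first by rewrite /is_leader ss sps.
    by rewrite /glued_len; case: ifP => _; lia.
  by rewrite /glued_pos ifT; [exact: subnKC|lia].
exists (partner s), ((len s).+1 + (m - s))%N; split.
- by rewrite /is_leader sp partnerK // ltnW.
- by rewrite /glued_len partnerK // lp ifF; lia.
- by rewrite /glued_pos partnerK // lp ifF; lia.
Qed.

End Blocks.

Lemma sq_summable_comp {R : realType} (X Y : choiceType) (h : X -> Y)
    (a : Y -> R) :
  injective h -> sq_summable a -> sq_summable (fun x => a (h x)).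
Proof.
move=> h_inj; apply: le_lt_trans; rewrite /sqsum.
rewrite -(@esum_image _ _ _ setT h (fun y => (a y ^+ 2)%:E)); last first.
  by move=> x y _ _ /h_inj.
rewrite [leRHS](esumID (range h)); last by move=> y _; rewrite lee_fin sqr_ge0.
by rewrite setTI leeDl // esum_ge0 // => y _; rewrite lee_fin sqr_ge0.
Qed.

(** * Square-summable sequences *)

Section Modulus.
Context {R : realType}.
Implicit Types x : R[i].

Lemma normc_eq0 x : (normc x == 0) = (x == 0).
Proof.
apply/eqP/eqP => [/ComplexField.Normc.eq0_normc //|->].
exact: ComplexField.Normc.normc0.
Qed.

Lemma normcJ x : normc x^* = normc x.
Proof. by case: x => x y /=; rewrite sqrrN. Qed.

Lemma normc_ge0 x : 0 <= normc x.
Proof. by case: x => x y; exact: sqrtr_ge0. Qed.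

End Modulus.

Section InnerProduct.
Context {R : realType}.
Local Notation H := (l2 R).
Implicit Types (f g : H) (a : R[i]).

Lemma l2_ext f g : f =1 g -> f = g.
Proof. by move=> fg; apply/val_inj/funext. Qed.

Lemma l2_summable f : sq_summable (fun n => normc (f n)).
Proof. by apply/asboolP; exact: (valP f). Qed.

Lemma l2_scaleE a f n : (a *: f) n = a * f n.
Proof. by []. Qed.

Lemma l2_basisE m n : l2_basis m n = (n == m)%:R :> R[i].
Proof. by []. Qed.

Lemma lim_series_single (u : nat -> R) n :
  (forall m, m != n -> u m = 0) -> limn (series u) = u n.
Proof.
move=> u0; apply/lim_near_cst; first exact: Rhausdorff.
exists n.+1 => // m /= nm; rewrite /series /= (bigD1_seq n) ?iota_uniq //=.
  by rewrite big1 ?addr0 // => i /u0.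
by rewrite mem_index_iota.
Qed.

Lemma inner_basisr f a n : inner f (a *: l2_basis n) = f n * a^*.
Proof.
rewrite /inner !(@lim_series_single _ n) => [|m /negPf mn|m /negPf mn];
  rewrite l2_scaleE l2_basisE ?mn ?mulr0 ?conjC0 ?mulr0 //.
by rewrite eqxx mulr1; case: (f n * _).
Qed.

Lemma inner_basisl f a n : inner (a *: l2_basis n) f = a * (f n)^*.
Proof.
rewrite /inner !(@lim_series_single _ n) => [|m /negPf mn|m /negPf mn];
  rewrite l2_scaleE l2_basisE ?mn ?mulr0 ?mul0r //.
by rewrite eqxx mulr1; case: (a * _).
Qed.

Lemma Re_mul_conj (x : R[i]) : complex.Re (x * x^*) = normc x ^+ 2.
Proof.
by case: x => x y /=; rewrite sqr_sqrtr ?addr_ge0 ?sqr_ge0 // !expr2 mulrN opprK.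
Qed.

Lemma series_sq_nondecreasing (u : nat -> R) :
  nondecreasing_seq (series (fun n => u n ^+ 2)).
Proof. by apply/nondecreasing_series => n _ _; exact: sqr_ge0. Qed.

(** A value of [limn] is meaningful only with convergence, obtained here from monotone partial sums
    bounded by the finite [esum]. *)
Lemma inner_self_cvg f :
  series (fun n => normc (f n) ^+ 2) @ \oo --> complex.Re (inner f f).
Proof.
rewrite /inner /=.
have -> : (fun n => complex.Re (f n * (f n)^*)) = (fun n => normc (f n) ^+ 2).
  by apply/funext => n; exact: Re_mul_conj.
apply: nondecreasing_is_cvgn; first exact: series_sq_nondecreasing.
have := l2_summable f; rewrite /sq_summable /sqsum.
set S := esum _ _ => Soo.
have S0 : (0 <= S)%E by apply: esum_ge0 => n _; rewrite lee_fin sqr_ge0.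
exists (fine S) => _ [n _ <-].
rewrite -lee_fin fineK ?ge0_fin_numE // /series /= /S.
rewrite -nneseries_esumT; last first.
  by move=> m; rewrite lee_fin sqr_ge0.
rewrite -sumEFin.
apply: nneseries_lim_ge => m _; by rewrite lee_fin sqr_ge0.
Qed.

Lemma sum_sq_le_inner f n :
  \sum_(b <- iota 0 n) normc (f b) ^+ 2 <= complex.Re (inner f f).
Proof.
have cvf := @inner_self_cvg f.
rewrite -(cvg_lim (@Rhausdorff R) cvf).
have := nondecreasing_cvgn_le (@series_sq_nondecreasing (fun b => normc (f b))).
move=> /(_ (cvgP _ cvf) n); by rewrite /series /= /index_iota subn0.
Qed.

Lemma sum_sq_gt_inner f e : 0 < e ->
  exists n, complex.Re (inner f f) - e < \sum_(b <- iota 0 n) normc (f b) ^+ 2.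
Proof.
move=> e0; have lt_l : complex.Re (inner f f) - e < complex.Re (inner f f).
  by rewrite ltrBlDr ltrDl.
have [n _ /(_ n)] := cvgr_gt _ (@inner_self_cvg f) _ lt_l.
by rewrite /series /= /index_iota subn0 => /(_ (leqnn n)); exists n.
Qed.

End InnerProduct.

(* The summability condition of the domain is automatic, as g is in l2. *)
Lemma weighted_shiftP {R : realType} (lam : nat -> R[i]) (f g : l2 R) :
  weighted_shift lam (f, g) <->
  forall n, g n = if n is m.+1 then lam m * f m else 0.
Proof.
split=> [[]//|gE]; split=> //.
rewrite [X in sq_summable X](_ : _ = fun n => normc (g n.+1)).
  exact: (sq_summable_comp (a := fun n => normc (g n)) succn_inj (l2_summable g)).
by apply/funext => n; rewrite gE mulrC.
Qed.

(** * The matrix of the conjugation *)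

Section SymmetricShift.
Context {R : realType} (lam : nat -> R[i]) (C : l2 R -> l2 R).
Local Notation W := (weighted_shift lam).
Local Notation e n := (l2_basis n : l2 R).

Hypothesis C_conj : conjugation C.
Hypothesis C_sym : C_symmetric C W.
Hypothesis C_dom : C @` range l2_basis `<=` dom_infty W.

Lemma conjugationK f : C (C f) = f.
Proof. by case: C_conj. Qed.

Lemma conjugation_inner f g : inner (C f) (C g) = inner g f.
Proof. by case: C_conj. Qed.

Lemma conjugationZ a f : C (a *: f) = a^* *: C f.
Proof.
case: C_conj => CD _ _; have C0 : C 0 = 0.
  have := CD 1 0 0; rewrite scaler0 addr0 conjC1 scale1r => /eqP.
  by rewrite addrC -subr_eq subrr eq_sym => /eqP.
by have := CD a f 0; rewrite C0 !addr0.
Qed.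

Lemma shift_basis n : W (e n, lam n *: e n.+1).
Proof.
apply/weighted_shiftP => -[|m]; rewrite [LHS]l2_scaleE !l2_basisE ?mulr0 //.
by rewrite eqSS; case: eqP => [->|_]; rewrite ?mulr0.
Qed.

(** Testing against [e n] shows that the adjoint acts as a weighted backward shift. *)
Lemma adjoint_shiftE f g n : adjoint W (f, g) -> g n = (lam n)^* * f n.+1.
Proof.
move=> /(_ _ _ (shift_basis n)) /=; rewrite inner_basisl -(scale1r (e n)).
rewrite inner_basisl mul1r => /(congr1 Num.conj).
by rewrite rmorphM /= !conjCK => <-.
Qed.

Lemma conj_opE T f g : conj_op C T (f, g) <-> T (C f, C g).
Proof.
split=> [[k]|Tfg].
  rewrite /fun_graph /mkset /= => -> [h Th ->]; by rewrite conjugationK.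
exists (C f) => //; exists (C g) => //.
by rewrite /fun_graph /mkset /= conjugationK.
Qed.

Lemma conj_op_shift f g : W (f, g) -> adjoint W (C f, C g).
Proof. by move=> /C_sym.2 /conj_opE. Qed.

Definition conj_coef (a b : nat) : R[i] := C (e a) b.

Lemma conj_coef_sym a b : conj_coef a b = conj_coef b a.
Proof.
have entry m n : conj_coef m n = inner (C (e m)) (e n).
  by rewrite -[e n]scale1r inner_basisr conjC1 mulr1.
by rewrite !entry -{1}(conjugationK (e b)) conjugation_inner.
Qed.

Lemma conj_coef_adjoint n m :
  (lam n)^* * conj_coef n.+1 m = (lam m)^* * conj_coef n m.+1.
Proof.
have /(adjoint_shiftE m) := conj_op_shift (shift_basis n).
by rewrite conjugationZ.
Qed.

Lemma basis_conj_in_dom n : exists g, W (C (e n), g).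
Proof.
have CE : (C @` range l2_basis) (C (e n)) by exists (e n) => //; exists n.
(* Exponent 1: [op_pow W 1] is [W] followed by the identity. *)
have [g] := C_dom CE (isT : (1 <= 1)%N).
by case=> k; rewrite /mkset /= => -> Wg; exists g.
Qed.

(** This is W C e_n = C W^* e_n. C-symmetry puts e_n in the domain of the adjoint, whose value there
    is computed by [adjoint_shiftE]. *)
Lemma shift_conj_basis n :
  W (C (e n), C (if n is m.+1 then (lam m)^* *: e m else 0)).
Proof.
have [g Wg] := basis_conj_in_dom n.
have := conj_op_shift Wg; rewrite conjugationK => aW.
have -> : (if n is m.+1 then (lam m)^* *: e m else 0) = C g; last first.
  by rewrite conjugationK.
apply: l2_ext => k; rewrite (adjoint_shiftE k aW) l2_basisE.
case: n {g Wg aW} => [|n]; first by rewrite mulr0.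
rewrite l2_scaleE l2_basisE eqSS; by case: eqP => [->|_]; rewrite ?mulr0.
Qed.

Lemma conj_coef_shift n m : lam m * conj_coef n.+1 m = lam n * conj_coef n m.+1.
Proof.
have [_ /(_ m.+1) /=] := shift_conj_basis n.+1.
by rewrite conjugationZ conjCK.
Qed.

Lemma conj_coef_first m : lam m * conj_coef 0 m = 0.
Proof.
have [_ /(_ m.+1) /= <-] := shift_conj_basis 0.
by rewrite -(scale0r (e 0)) conjugationZ conjC0 scale0r.
Qed.

Lemma shift_C_selfadjoint : C_selfadjoint C W.
Proof.
split; first by case: C_sym.
apply/seteqP; split; first by case: C_sym.
move=> [f g] /conj_opE aW.
apply/weighted_shiftP => n.
(* Since [C] swaps the arguments of [inner], this reads <f, W^* e_n> = <g, e_n>, which is coordinate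
   [n] of [g]. *)
have := aW _ _ (shift_conj_basis n); rewrite !conjugation_inner -[e n]scale1r.
rewrite inner_basisr conjC1 mulr1 => <-.
case: n => [|n]; last by rewrite inner_basisr conjCK mulrC.
by rewrite -(scale0r (e 0)) inner_basisr conjC0 mulr0.
Qed.

(** * The doubly stochastic matrix of squared moduli *)

Definition modulus (n : nat) : R := normc (lam n).

Definition mass (a b : nat) : R := normc (conj_coef a b) ^+ 2.

Lemma inner_basis_self n : inner (e n) (e n) = 1.
Proof.
by rewrite -[X in inner X _]scale1r inner_basisl mul1r l2_basisE eqxx conjC1.
Qed.

Lemma mass_row_le1 a N : \sum_(b <- iota 0 N) mass a b <= 1.
Proof.
apply: le_trans (sum_sq_le_inner (C (e a)) N) _.
by rewrite conjugation_inner inner_basis_self.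
Qed.

Lemma mass_row_ge1 a eps : 0 < eps ->
  exists N, 1 - eps < \sum_(b <- iota 0 N) mass a b.
Proof.
move=> /(sum_sq_gt_inner (C (e a))) [N].
by rewrite conjugation_inner inner_basis_self; exists N.
Qed.

Lemma mass_ge0 a b : 0 <= mass a b.
Proof. exact: sqr_ge0. Qed.

Lemma mass_sym a b : mass a b = mass b a.
Proof. by rewrite /mass conj_coef_sym. Qed.

Lemma mass_neq0 a b : (mass a b != 0) = (conj_coef a b != 0).
Proof. by rewrite /mass sqrf_eq0 normc_eq0. Qed.

(** The two relations give |lam_n|^2 |c(n+1,m)| = |lam_n lam_m c(n,m+1)| = |lam_m|^2 |c(n+1,m)|. *)
Lemma conj_coef_weights n m :
  conj_coef n.+1 m != 0 -> modulus n = modulus m.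
Proof.
rewrite -normc_eq0 => k0.
have := congr1 (@ComplexField.Normc.normc R) (conj_coef_shift n m).
have := congr1 (@ComplexField.Normc.normc R) (conj_coef_adjoint n m).
rewrite !ComplexField.Normc.normcM !normcJ -/(modulus n) -/(modulus m) => k1 k2.
have : modulus n ^+ 2 * normc (conj_coef n.+1 m) =
    modulus m ^+ 2 * normc (conj_coef n.+1 m).
  by rewrite !expr2 -!mulrA k1 k2 mulrCA.
move=> /(mulIf k0) /eqP.
by rewrite eqrXn2 ?normc_ge0 // => /eqP.
Qed.

Lemma mass_support a b : mass a b != 0 -> pred_weight modulus a = modulus b.
Proof.
rewrite mass_neq0; case: a => [k0|a]; last exact: conj_coef_weights.
have /eqP := conj_coef_first b; rewrite mulf_eq0 (negPf k0) orbF => /eqP lb.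
by rewrite /modulus lb ComplexField.Normc.normc0.
Qed.

Lemma mass_shift a b : modulus a != 0 -> mass a b.+1 != 0 -> mass a.+1 b != 0.
Proof.
rewrite !mass_neq0 normc_eq0 => wa kab; apply: contraTneq isT => k0.
have /esym/eqP := conj_coef_shift a b; rewrite k0 mulr0 mulf_eq0.
by rewrite (negPf wa) (negPf kab).
Qed.

(** If no weight vanished from [n] on, induction on the row would kill all entries in columns
    [b >= n]; by symmetry row [n] would be zero, although its mass is 1. *)
Lemma weight_zero n : exists l, modulus (n + l) == 0.
Proof.
apply: contrapT => noz.
have wn b : (n <= b)%N -> modulus b != 0.
  by move=> nb; apply/negP => wb; apply: noz; exists (b - n)%N; rewrite subnKC.
have m0 a : forall b, (n <= b)%N -> mass a b = 0.
  elim: a => [|a IH] b nb; apply: contrapT => /eqP mab;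
    have wab := mass_support mab.
    by have := wn _ nb; rewrite -wab eqxx.
  have /eqP := IH b.+1 (leqW nb); apply/negP.
  rewrite mass_neq0.
  apply: contraNneq (_ : lam b * conj_coef a.+1 b != 0) => [k0|].
    by rewrite conj_coef_shift k0 mulr0.
  by rewrite mulf_neq0 -?normc_eq0 ?wn // normc_eq0 -mass_neq0.
have [N] := mass_row_ge1 n ltr01; rewrite subrr big1_seq ?ltxx // => b _.
by rewrite mass_sym m0.
Qed.

End SymmetricShift.

(** * Decomposition into truncated shifts *)

Section TruncatedShift.
Context {R : realType} (k : nat) (mu : 'I_k -> R[i]).
Implicit Types v : 'cV[R[i]]_k.+1.

Lemma truncated_shift_first v : (truncated_shift mu *m v) ord0 0 = 0.
Proof.
rewrite mxE big1 // => l _; rewrite /truncated_shift summxE big1 ?mul0r // => j _.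
by rewrite !mxE /= mulr0.
Qed.

Lemma truncated_shift_lift v (j : 'I_k) :
  (truncated_shift mu *m v) (lift ord0 j) 0 = mu j * v (widen_ord (leqnSn k) j) 0.
Proof.
have entry l : truncated_shift mu (lift ord0 j) l =
    mu j * (l == widen_ord (leqnSn k) j)%:R.
  rewrite /truncated_shift summxE (bigD1 j) //= !mxE eqxx big1 ?addr0 // => i ij.
  by rewrite !mxE (inj_eq lift_inj) eq_sym (negPf ij) mulr0.
rewrite mxE (bigD1 (widen_ord (leqnSn k) j)) //= entry eqxx mulr1 big1 ?addr0 //.
by move=> l /negPf lj; rewrite entry lj mulr0 mul0r.
Qed.

Lemma mul_truncated_shiftP v u :
  u = truncated_shift mu *m v <->
  u ord0 0 = 0 /\
  forall j : 'I_k, u (lift ord0 j) 0 = mu j * v (widen_ord (leqnSn k) j) 0.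
Proof.
split=> [->|[u0 uS]].
  by split=> [|j]; rewrite ?truncated_shift_first ?truncated_shift_lift.
apply/colP => r; have [j ->|->] := unliftP ord0 r.
  by rewrite truncated_shift_lift.
by rewrite truncated_shift_first.
Qed.

End TruncatedShift.

(** * Regrouping the standard basis into finite blocks *)

Section Reindexing.
Context {R : realType} (lam : nat -> R[i]).
Variables (I : choiceType) (k : I -> nat) (pos : I -> nat -> nat).
Hypothesis pos_inj : forall s t i j, (i <= k s)%N -> (j <= k t)%N ->
  pos s i = pos t j -> s = t /\ i = j.
Hypothesis pos_surj : forall m, exists s j, (j <= k s)%N /\ pos s j = m.
Hypothesis pos_first : forall s, pred_weight lam (pos s 0) = 0.
Hypothesis pos_step : forall s j, (j < k s)%N ->
  pos s j.+1 = (pos s j).+1 \/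
  lam (pos s j) = 0 /\ pred_weight lam (pos s j.+1) = 0.

Definition columns (h : nat -> R[i]) (i : I) : 'cV[R[i]]_(k i).+1 :=
  \col_(j < (k i).+1) h (pos i j).

(** [pos] is a bijection from the pairs [(i, j)] with [j <= k i] onto the indices, and the sum over
    pairs is taken first over [j]. Stated for arbitrary sequences, it also yields membership in
    [l2]. *)
Lemma sqsum_columns (h : nat -> R[i]) :
  sqsum (fun i => cV_norm (columns h i)) = sqsum (fun m => normc (h m)).
Proof.
rewrite /sqsum (@reindex_esum _ _ _ ([set: I] `*`` (fun i => `I_(k i).+1))
  [set: nat] (fun x => pos x.1 x.2)); last first.
  split => //.
    move=> [s i] [t j]; rewrite !inE /= => -[_ si] [_ tj] st.
    by have [-> ->] := pos_inj si tj st.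
  by move=> m _; have [s [j [jk <-]]] := pos_surj m; exists (s, j).
rewrite -(@esum_esum _ _ _ setT (fun i => `I_(k i).+1)
  (fun i j => (normc (h (pos i j)) ^+ 2)%:E)); last first.
  by move=> i j _ _; rewrite lee_fin sqr_ge0.
apply: eq_esum => i _; rewrite esum_fset //; last first.
  by move=> j _; rewrite lee_fin sqr_ge0.
rewrite -fsbig_ord sumEFin /cV_norm sqr_sqrtr; last first.
  by apply: sumr_ge0 => j _; exact: sqr_ge0.
by congr EFin; apply: eq_bigr => j _; rewrite mxE.
Qed.

Lemma columns_unitary : unitary_onto_hsum (fun f : l2 R => columns f).
Proof.
split=> [a f g i|f|x xs].
- by apply/colP => j; rewrite !mxE.
- exact: sqsum_columns.
(* [q] inverts [pos], so reading [x] along [q] gives the preimage. *)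
have /choice [q qP] : forall m, exists sj : I * nat,
    (sj.2 <= k sj.1)%N /\ pos sj.1 sj.2 = m.
  by move=> m; have [s [j sj]] := pos_surj m; exists (s, j).
pose h m : R[i] := x (q m).1 (inord (q m).2) 0.
have hx : columns h = x.
  apply: functional_extensionality_dep => i; apply/colP => j; rewrite mxE /h.
  have [q_le q_pos] := qP (pos i j).
  have [] := pos_inj q_le (ltn_ord j : (j <= k i)%N) q_pos.
  by case: (q _) => /= s l -> ->; rewrite inord_val.
have hl2 : h \in l2_pred.
  by apply/asboolP; rewrite /sq_summable -sqsum_columns hx.
by exists (L2 hl2).
Qed.

Lemma shift_columns :
  weighted_shift lam = [set p : l2 R * l2 R | orthogonal_sum (fun i =>
    fun_graph (mulmx (truncated_shift (fun j : 'I_(k i) => lam (pos i j)))))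
    (columns p.1, columns p.2)].
Proof.
(* At [n = 0] the default [n.-1 = 0] is masked by the factor [pred_weight lam 0 = 0]. *)
have plE (f : l2 R) n :
    (if n is m.+1 then lam m * f m else 0) = pred_weight lam n * f n.-1.
  by case: n => [|n] //=; rewrite mul0r.
(* At a joint both sides vanish. *)
have step (f g : l2 R) s j : (j < k s)%N ->
    pred_weight lam (pos s j.+1) * f (pos s j.+1).-1 =
    lam (pos s j) * f (pos s j).
  by move=> /pos_step[->//|[-> ->]]; rewrite !mul0r.
have l2_hsum (f : l2 R) : in_hsum (columns f).
  by rewrite /in_hsum /sq_summable sqsum_columns; exact: l2_summable.
apply/seteqP; split=> -[f g].
  move=> [_ gE]; split=> //= i; apply/mul_truncated_shiftP; split.
    by rewrite mxE gE plE pos_first mul0r.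
  by move=> j; rewrite !mxE gE plE step.
move=> [/= Ui _ _].
apply/weighted_shiftP => n; have [s [j [js <-]]] := pos_surj n; rewrite plE.
have /mul_truncated_shiftP[U0 US] := Ui s.
case: j js => [|j] js.
  by move: U0; rewrite mxE => ->; rewrite pos_first mul0r.
by rewrite step //; have := US (Ordinal js); rewrite !mxE.
Qed.

End Reindexing.

Lemma normc_modulus (R : realType) (lam : nat -> R[i]) n :
  `|lam n| = (modulus lam n)%:C%C.
Proof. by rewrite /modulus normc_def; case: (lam n). Qed.

Theorem theorem28 (R : realType) (lam : nat -> R[i]) (C : l2 R -> l2 R) :
  conjugation C ->
  C_symmetric C (weighted_shift lam) ->
  C @` range l2_basis `<=` dom_infty (weighted_shift lam) ->
  C_selfadjoint C (weighted_shift lam) /\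
  exists (I : choiceType) (k : I -> nat) (mu : forall i, 'I_(k i) -> R[i])
         (U : l2 R -> forall i, 'cV[R[i]]_(k i).+1),
    [/\ unitary_onto_hsum U,
        weighted_shift lam = [set p | orthogonal_sum
          (fun i => fun_graph (mulmx (truncated_shift (mu i)))) (U p.1, U p.2)]
      & forall i (j : 'I_(k i)), `|mu i j| = `|mu i (rev_ord j)|].
Proof.
move=> C_conj C_sym C_dom; split; first exact: shift_C_selfadjoint.
pose w := modulus lam.
have w_zero : forall n, exists l, w (n + l)%N == 0.
  exact: weight_zero C_conj C_sym C_dom.
have supp := mass_support C_conj C_sym C_dom.
have shft := mass_shift C_conj C_sym C_dom.
have le1 := mass_row_le1 C_conj.
have ge1 := mass_row_ge1 C_conj.
have sym := mass_sym C_conj.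
have ge0 := mass_ge0 C.
pose I : choiceType := {s : nat | is_leader w_zero s}.
pose k (s : I) := glued_len w_zero (val s).
pose pos (s : I) j := glued_pos w_zero (val s) j.
have I_start (s : I) : is_start w (val s) by have /andP[] := valP s.
have lam0 n : w n = 0 -> lam n = 0 by exact: ComplexField.Normc.eq0_normc.
have start0 n : is_start w n -> pred_weight lam n = 0.
  by case: n => // n /eqP /lam0.
have pos_inj s t i j : (i <= k s)%N -> (j <= k t)%N ->
    pos s i = pos t j -> s = t /\ i = j.
  move=> si tj st.
  have := glued_inj ge0 sym supp shft le1 ge1 (valP s) (valP t) si tj st.
  by case=> /val_inj.
have pos_surj m : exists s j, (j <= k s)%N /\ pos s j = m.
  have [s [j [ls js sj]]] := glued_surj w_zero ge0 sym supp shft le1 ge1 m.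
  by exists (exist _ s ls), j.
have pos_first s : pred_weight lam (pos s 0) = 0.
  by apply: start0; rewrite /pos /glued_pos /= addn0; exact: I_start.
have pos_step s j : (j < k s)%N -> pos s j.+1 = (pos s j).+1 \/
    lam (pos s j) = 0 /\ pred_weight lam (pos s j.+1) = 0.
  move=> js; have := glued_step ge0 sym supp shft le1 ge1 (I_start s) js.
  by case=> [|[/lam0 ? /start0 ?]]; [left|right].
exists I, k, (fun i j => lam (pos i j)), (fun f => columns k pos f); split.
- exact: columns_unitary.
- exact: shift_columns.
- move=> i j; rewrite !normc_modulus.
  have -> // : modulus lam (pos i j) = modulus lam (pos i (rev_ord j)).
  have := glued_palindrome ge0 sym supp shft le1 ge1 (I_start i) (ltn_ord j).
  by move=> /esym.
Qed.
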